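(* Let $X,Y$ be independent identically distributed positive random variables possessing finite moments of all orders. Let $0<p<1$ and let $\varepsilon_p$ be a Bernoulli random variable, independent of $(X,Y)$, taking the value $1$ with probability $p$ and the value $0$ with probability $1-p$. Then the conditional expectation $$\mathbb{E}\{\,pX+(1-\varepsilon_p)Y \mid (1-p)X+\varepsilon_p Y\,\}$$ is almost surely equal to a constant if and only if $X$ has an exponential distribution.
   Context: ''Exponential distribution'' means an exponential distribution on $(0,\infty)$ with an arbitrary scale parameter $\lambda>0$, i.e. the distribution with Laplace transform $\mathbb{E}e^{-sX}=1/(1+\lambda s)$, $s\ge 0$, for some $\lambda>0$. *)

(* Defs.v *)
From HB Require Import structures.
From mathcomp Require Import all_boot all_order all_algebra.
From mathcomp Require Import all_classical all_reals all_analysis.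

Set Implicit Arguments.
Unset Strict Implicit.
Unset Printing Implicit Defensive.

Import Order.TTheory GRing.Theory Num.Theory.
Import numFieldNormedType.Exports.

Local Open Scope classical_set_scope.
Local Open Scope ring_scope.

(* Taking T1 or T2 to be a product type gives independence from a random
   vector, with respect to the product sigma-algebra. *)
Definition indep_rv d d1 d2 (T : measurableType d) (T1 : measurableType d1)
    (T2 : measurableType d2) (R : realType) (P : probability T R)
    (X : T -> T1) (Y : T -> T2) : Prop :=
  forall (A : set T1) (B : set T2), measurable A -> measurable B ->
    P (X @^-1` A `&` Y @^-1` B) = (P (X @^-1` A) * P (Y @^-1` B))%E.

(* Laws are compared on measurable sets only: a plain equality of the functions
   [set R -> \bar R] would also constrain their meaningless values elsewhere. *)
Definition ident_distr d (T : measurableType d) (R : realType)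
    (P : probability T R) (X Y : {RV P >-> R}) : Prop :=
  forall A : set R, measurable A -> distribution P X A = distribution P Y A.

(* The library's [exponential_prob] takes the rate, i.e. the inverse of the
   scale parameter [lambda]: density [lambda^-1 * expR (- lambda^-1 * x)]. *)
Definition exponentially_distributed d (T : measurableType d) (R : realType)
    (P : probability T R) (X : {RV P >-> R}) : Prop :=
  exists2 lambda : R, 0 < lambda &
    forall A : set R, measurable A ->
      distribution P X A = exponential_prob lambda^-1 A.

(* [Z] is a version of the conditional expectation [E(U | V)], i.e. of the
   conditional expectation of [U] given the sigma-algebra generated by [V].
   For integrable [U] versions exist and any two of them agree almost surely.
   The arguments of [measurable_fun] are explicit so that [Z] is measurable for
   the generated sigma-algebra rather than for that of [T]. *)
Definition cond_exp_version d (T : measurableType d) (R : realType)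
    (P : probability T R) (U V Z : T -> R) : Prop :=
  [/\ @measurable_fun _ _ (g_sigma_algebra_preimageType V) R [set: T] Z,
      P.-integrable [set: T] (EFin \o Z) &
      forall A : set T, g_sigma_algebra_preimage V A ->
        (\int[P]_(w in A) (Z w)%:E = \int[P]_(w in A) (U w)%:E)%E].

Definition cond_exp_ae_constant d (T : measurableType d) (R : realType)
    (P : probability T R) (U V : T -> R) : Prop :=
  exists2 Z : T -> R, cond_exp_version P U V Z &
    exists c : R, {ae P, forall w, Z w = c}.

(* Main.v *)
(* Write q = 1 - p, U and V for the two combinations of X and Y, and
   m_n = E X^n. If E(U | V) is constant, the constant is E U = m_1, so
   E(U V^n) = m_1 E(V^n) for every n. Expanding over the two values of the
   Bernoulli variable gives a recursion in which m_{n+1} has the nonzero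
   coefficient p q^n, hence at most one solution for each m_1; n! m_1^n is one.
   Conversely, if X is exponential the same identities say that
   A |-> E(U; V in A) and A |-> m_1 P(V in A) have the same moments.
   In both directions one concludes by the determinacy of the moment problem on
   [0, +oo[ under an exponential moment: the functions whose two integrals agree
   are stable under dominated limits, so expanding exp(- h x) in power series
   carries agreement from x^k exp(- n h x) to x^k exp(- (n + 1) h x); then
   exp(- n exp(- n h (x - c))), a series in the exp(- j n h x), tends to the
   indicator of ]c, +oo[. *)
Require Import Defs.
From HB Require Import structures.
From mathcomp Require Import all_boot all_order all_algebra.
From mathcomp Require Import all_classical all_reals all_analysis.
From mathcomp Require Import measurable_realfun ring lra zify.

Set Implicit Arguments.
Unset Strict Implicit.
Unset Printing Implicit Defensive.

Import Order.TTheory GRing.Theory Num.Theory.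
Import numFieldNormedType.Exports.

Local Open Scope classical_set_scope.
Local Open Scope ring_scope.

(** * Integrals of real-valued functions *)

Section RealIntegral.
Context d (T : measurableType d) (R : realType).
Variable mu : {measure set T -> \bar R}.

(** Dominated convergence, applied to the constant sequence [f], accepts a bound that holds only
    almost everywhere and returns integrability of the limit. *)
Lemma ae_le_integrable (f g : T -> R) :
  measurable_fun [set: T] f ->
  {ae mu, forall x, `|f x| <= g x} ->
  mu.-integrable [set: T] (EFin \o g) ->
  mu.-integrable [set: T] (EFin \o f).
Proof.
move=> mf fg ig.
have mf' : measurable_fun setT (EFin \o f) by exact/measurable_EFinP.
have cf : {ae mu, forall x, [set: T] x ->
    (fun=> (EFin \o f) x) @ \oo --> (EFin \o f) x}.
  by apply: aeW => x _; exact: cvg_cst.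
have fg' : {ae mu, forall x (n : nat), [set: T] x ->
    (`|(EFin \o f) x| <= (EFin \o g) x)%E}.
  by move: fg; apply: filterS => x fgx _ _; rewrite /= lee_fin.
by have [] := dominated_convergence measurableT (fun=> mf') mf' cf ig fg'.
Qed.

Lemma ae_eq_integrable (f g : T -> R) :
  measurable_fun [set: T] f -> {ae mu, forall x, f x = g x} ->
  mu.-integrable [set: T] (EFin \o g) ->
  mu.-integrable [set: T] (EFin \o f).
Proof.
move=> mf fg ig.
apply: (ae_le_integrable (g := Num.norm \o g)) => //.
  by move: fg; apply: filterS => x -> /=.
exact: integrable_norm.
Qed.

Lemma ae_eq_Rintegral (f g : T -> R) :
  measurable_fun [set: T] f -> measurable_fun [set: T] g ->
  {ae mu, forall x, f x = g x} ->
  \int[mu]_x f x = \int[mu]_x g x.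
Proof.
move=> mf mg fg; congr fine; apply: ae_eq_integral => //.
- exact/measurable_EFinP.
- exact/measurable_EFinP.
- by move: fg; apply: filterS => x -> .
Qed.

Lemma Rdominated_convergence (f_ : (T -> R)^nat) (f g : T -> R) :
  (forall n, measurable_fun [set: T] (f_ n)) -> measurable_fun [set: T] f ->
  {ae mu, forall x, f_ ^~ x @ \oo --> f x} ->
  {ae mu, forall x, forall n, `|f_ n x| <= g x} ->
  mu.-integrable [set: T] (EFin \o g) ->
  (fun n => \int[mu]_x f_ n x) @ \oo --> \int[mu]_x f x.
Proof.
move=> mf_ mf cf fg ig.
have mf' : measurable_fun setT (EFin \o f) by exact/measurable_EFinP.
have mf_' n : measurable_fun setT (EFin \o f_ n) by exact/measurable_EFinP.
have cf' : {ae mu, forall x, [set: T] x ->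
    (fun n => (EFin \o f_ n) x) @ \oo --> (EFin \o f) x}.
  move: cf; apply: filterS => x cfx _ /=.
  by apply: cvg_EFin => //; exact: nearW.
have fg' : {ae mu, forall x n, [set: T] x ->
    (`|(EFin \o f_ n) x| <= (EFin \o g) x)%E}.
  by move: fg; apply: filterS => x fgx n _; rewrite /= lee_fin.
have [ifE _ cvgI] := dominated_convergence measurableT mf_' mf' cf' ig fg'.
apply: (@fine_cvg _ _ _ _ _ _).
rewrite /Rintegral fineK//; exact: integrable_fin_num.
Qed.

Lemma integrableZ_EFin (k : R) (f : T -> R) :
  mu.-integrable [set: T] (EFin \o f) ->
  mu.-integrable [set: T] (EFin \o (fun x => k * f x)).
Proof. by move=> fi; exact: (integrableZl measurableT k fi). Qed.

Lemma integrableD_EFin (f g : T -> R) :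
  mu.-integrable [set: T] (EFin \o f) -> mu.-integrable [set: T] (EFin \o g) ->
  mu.-integrable [set: T] (EFin \o (fun x => f x + g x)).
Proof. by move=> fi gi; exact: (integrableD measurableT fi gi). Qed.

Lemma integrable_sum_EFin (I : Type) (s : seq I) (f : I -> T -> R) :
  (forall i, mu.-integrable [set: T] (EFin \o f i)) ->
  mu.-integrable [set: T] (EFin \o (fun x => \sum_(i <- s) f i x)).
Proof.
move=> fi; rewrite (_ : _ \o _ = fun x => \sum_(i <- s) (f i x)%:E)%E.
  by apply: integrable_sum => // i _; exact: fi.
by apply/funext => x /=; rewrite sumEFin.
Qed.

Lemma Rintegral_sum (I : Type) (s : seq I) (f : I -> T -> R) :
  (forall i, mu.-integrable [set: T] (EFin \o f i)) ->
  \int[mu]_x (\sum_(i <- s) f i x) = \sum_(i <- s) \int[mu]_x f i x.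
Proof.
move=> fi; elim: s => [|i s IH].
  under eq_Rintegral do rewrite big_nil.
  by rewrite big_nil Rintegral_cst// mul0r.
under eq_Rintegral do rewrite big_cons.
by rewrite big_cons RintegralD ?IH//; exact: integrable_sum_EFin.
Qed.

End RealIntegral.

(** * Determinacy of moments *)

Section ExpSeries.
Context (R : realType).
Implicit Types (x y : R) (n k : nat).

Lemma series_exp_coeff_le x n : 0 <= x -> series (exp_coeff x) n <= expR x.
Proof.
move=> x0; apply: nondecreasing_cvgn_le; last exact: is_cvg_series_exp_coeff.
apply/nondecreasing_seqP => m; rewrite /series/= big_nat_recr//= lerDl.
exact: exp_coeff_ge0.
Qed.

Lemma norm_series_exp_coeff_le x n :
  `|series (exp_coeff x) n| <= expR `|x|.
Proof.
apply: le_trans (series_exp_coeff_le n (normr_ge0 x)).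
rewrite /series/=; apply: le_trans (ler_norm_sum _ _ _) _.
by apply: ler_sum => i _; rewrite normrM normrX normfV [`|_%:R|]ger0_norm.
Qed.

(** Up to the factorial, the power is the last term of the partial sum of length [n.+1], whose other
    terms are nonnegative. *)
Lemma exprn_le_expR x n : 0 <= x -> x ^+ n <= n`!%:R * expR x.
Proof.
move=> x0; rewrite mulrC -ler_pdivrMr ?ltr0n ?fact_gt0//.
apply: le_trans (series_exp_coeff_le n.+1 x0).
rewrite /series/= big_nat_recr//= lerDr.
by apply: sumr_ge0 => i _; exact: exp_coeff_ge0.
Qed.

End ExpSeries.

(* [W] is the weight allowed in dominations; nothing is asked on negative
   arguments, since the variables plugged into test functions are almost surely
   nonnegative. *)
Record test_class (R : realType) (W : R -> R) (S : (R -> R) -> Prop) : Prop := {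
  test_add : forall f g, S f -> S g -> S (fun x => f x + g x);
  test_scale : forall a g, S g -> S (fun x => a * g x);
  test_lim : forall (f : (R -> R)^nat) (g : R -> R) C, (forall n, S (f n)) ->
    measurable_fun [set: R] g ->
    (forall n x, 0 <= x -> `|f n x| <= C * W x) ->
    (forall x, 0 <= x -> f ^~ x @ \oo --> g x) -> S g }.

Section TestClass.
Context (R : realType) (W : R -> R) (S : (R -> R) -> Prop).
Hypothesis TS : test_class W S.

Lemma test_sum (I : Type) (s : seq I) (f : I -> R -> R) :
  S (cst 0) -> (forall i, S (f i)) -> S (fun x => \sum_(i <- s) f i x).
Proof.
move=> S0 Sf; elim: s => [|i s IH].
  by rewrite (_ : (fun _ => _) = cst 0)//; apply/funext => x; rewrite big_nil.
rewrite (_ : (fun _ => _) = fun x => f i x + \sum_(j <- s) f j x).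
  exact: test_add TS _ _ (Sf i) IH.
by apply/funext => x; rewrite big_cons.
Qed.

Lemma test0 g : S g -> S (cst 0).
Proof.
move=> Sg; rewrite (_ : cst 0 = fun x => 0 * g x).
  exact: test_scale TS _ _ Sg.
by apply/funext => x; rewrite mul0r.
Qed.

End TestClass.

(** * From powers to indicators of Borel sets *)

Section Determinacy.
Context (R : realType) (h : R) (S : (R -> R) -> Prop).
Hypothesis h_gt0 : 0 < h.
(** One factor [expR (h * x)] absorbs a power of [x], the other bounds the partial sums of the
    series of [expR (- (h * x))]. *)
Let W (x : R) := expR (2 * h * x).
Hypothesis TS : test_class W S.
Hypothesis Smon : forall k, S (fun x => x ^+ k).

Let W_ge1 x : 0 <= x -> 1 <= W x.
Proof. by move=> x0; rewrite /W leNgt expR_lt1 -leNgt !mulr_ge0// ltW. Qed.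

(** Expanding one factor [expR (- (h * x))] at a time keeps the domination within [W] for every [n];
    expanding [expR (- (n%:R * h * x))] at once would require the weight to grow with [n]. The
    induction is uniform in [k] because the partial sums bring in higher powers of [x]. *)
Lemma test_exprn_expR k n : S (fun x => x ^+ k * expR (- (n%:R * h * x))).
Proof.
elim: n k => [|n IH] k.
  rewrite (_ : (fun _ => _) = fun x => x ^+ k)//.
  by apply/funext => x; rewrite !mul0r oppr0 expR0 mulr1.
pose f N x := x ^+ k * expR (- (n%:R * h * x)) * series (exp_coeff (- (h * x))) N.
(* The constant comes from [exprn_le_expR] at [h * x]. *)
apply: (test_lim TS (f := f) (C := k`!%:R / h ^+ k)).
- move=> N; rewrite (_ : f N = fun x => \sum_(0 <= j < N)
      (- h) ^+ j / j`!%:R * (x ^+ (k + j) * expR (- (n%:R * h * x)))).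
    apply: (test_sum TS); first exact: (test0 TS (Smon 0)).
    by move=> i; apply: (test_scale TS); exact: IH.
  apply/funext => x; rewrite /f /series/= mulr_sumr.
  apply: eq_bigr => i _; rewrite /exp_coeff/= exprD -(mulNr h x) exprMn.
  by ring.
- apply: measurable_funM; first exact: exprn_measurable.
  apply: measurableT_comp => //; apply: measurableT_comp => //.
- move=> N x x0; rewrite /f /W.
  have hx0 : 0 <= h * x by rewrite mulr_ge0// ltW.
  have hk0 : 0 < h ^+ k by rewrite exprn_gt0.
  have -> : 2 * h * x = h * x + h * x by ring.
  rewrite !normrM expRD (ger0_norm (expR_ge0 _)) ger0_norm ?exprn_ge0//.
  rewrite mulrA ler_pM//.
  + by rewrite mulr_ge0// ?expR_ge0// exprn_ge0.
  + apply: (@le_trans _ _ (x ^+ k)).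
      rewrite ler_piMr ?exprn_ge0// expR_le1 oppr_le0 -mulrA mulr_ge0//.
    rewrite mulrAC ler_pdivlMr// mulrC -exprMn.
    exact: exprn_le_expR.
  + rewrite (le_trans (norm_series_exp_coeff_le _ _))// normrN ger0_norm//.
- move=> x x0; rewrite /f -natr1 !mulrDl mul1r opprD expRD mulrA.
  by apply: cvgMr; exact: is_cvg_series_exp_coeff.
Qed.

(* The factor [n%:R] forces the limit 0 at [x = c]. *)
Let gumbel (c : R) (n : nat) x := expR (- (n%:R * expR (- (n%:R * h * (x - c))))).

Let measurable_gumbel c n : measurable_fun [set: R] (gumbel c n).
Proof.
apply: measurableT_comp => //; apply: measurableT_comp => //.
apply: measurable_funM => //; apply: measurableT_comp => //.
apply: measurableT_comp => //; apply: measurable_funM => //.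
exact: measurable_funB.
Qed.

(** For fixed [n] the inner exponential is bounded on nonnegative [x], so the partial sums of the
    outer series are bounded uniformly; the term of index [j] is a multiple of
    [expR (- ((j * n)%:R * h * x))]. *)
Lemma test_gumbel c n : S (gumbel c n).
Proof.
pose f N x :=
  series (exp_coeff (- (n%:R * expR (- (n%:R * h * (x - c)))))) N.
(* [n%:R * expR (n%:R * h * c)] is the value at [x = 0] of a decreasing function of [x]. *)
apply: (test_lim TS (f := f) (C := expR (n%:R * expR (n%:R * h * c)))) => //.
- move=> N; rewrite (_ : f N = fun x => \sum_(0 <= j < N)
      ((- (n%:R * expR (n%:R * h * c))) ^+ j / j`!%:R) *
      (x ^+ 0 * expR (- ((j * n)%:R * h * x)))).
    apply: (test_sum TS); first exact: (test0 TS (Smon 0)).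
    by move=> i; apply: (test_scale TS); exact: test_exprn_expR.
  apply/funext => x; rewrite /f /series/=.
  apply: eq_bigr => j _; rewrite /exp_coeff/= expr0 mul1r.
  have -> : - ((j * n)%:R * h * x) = j%:R * (- (n%:R * h * x)).
    by rewrite natrM; ring.
  have -> : - (n%:R * h * (x - c)) = n%:R * h * c + - (n%:R * h * x) by ring.
  by rewrite expRD (expRM_natl j) [RHS]mulrAC -exprMn mulNr mulrA.
- move=> N x x0; rewrite /f.
  apply: le_trans (norm_series_exp_coeff_le _ _) _.
  rewrite normrN ger0_norm ?mulr_ge0 ?expR_ge0//.
  apply: (@le_trans _ _ (expR (n%:R * expR (n%:R * h * c)))).
    rewrite ler_expR ler_wpM2l// ler_expR mulrBr opprB lerBlDr lerDl.
    by rewrite !mulr_ge0// ltW.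
  by rewrite ler_peMr ?expR_ge0// W_ge1.
- by move=> x x0; rewrite /f; exact: is_cvg_series_exp_coeff.
Qed.

Lemma test_indic_itv c : S (\1_`]c, +oo[ : R -> R).
Proof.
apply: (test_lim TS (f := gumbel c) (C := 1)).
- exact: test_gumbel.
- exact: measurable_indic.
- move=> n x x0; rewrite ger0_norm ?expR_ge0// mul1r.
  apply: le_trans (W_ge1 x0).
  by rewrite expR_le1 oppr_le0 mulr_ge0// expR_ge0.
- move=> x x0; rewrite indicE/=.
  have [cx|xc] := ltP c x.
    rewrite mem_set/= ?in_itv/= ?cx// -[X in _ --> X]expR0 -oppr0.
    apply: continuous_cvg; first exact: continuous_expR.
    apply: cvgN.
    (* It remains to see that [n%:R * expR (- (n%:R * del))] tends to 0. The quadratic case of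
       [exprn_le_expR] bounds it by a multiple of [n%:R^-1]; the linear case would only give
       boundedness. *)
    pose del := h * (x - c).
    have del0 : 0 < del by rewrite mulr_gt0// subr_gt0.
    apply: (squeeze_cvgr (f := fun=> 0) (h := fun n : nat => 2 / del ^+ 2 * n%:R^-1)).
    + near=> n; have n0 : 0 < n%:R :> R by rewrite ltr0n; near: n; exact: nbhs_infty_gt.
      rewrite mulr_ge0 ?expR_ge0//= expRN -mulrA -/del.
      have nd : 0 <= n%:R * del by rewrite mulr_ge0// ltW.
      have := exprn_le_expR 2 nd; rewrite exprMn /= => H.
      rewrite ler_pdivrMr ?expR_gt0// mulrC mulrA ler_pdivlMr//.
      rewrite mulrCA mulrA ler_pdivlMr ?exprn_gt0//.
    + exact: cvg_cst.
    + rewrite -[X in _ --> X](mulr0 (2 / del ^+ 2)); apply: cvgMr.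
      apply/gtr0_cvgV0; last exact: cvgr_idn.
      by near=> n; rewrite ltr0n; near: n; exact: nbhs_infty_gt.
  rewrite memNset/= ?in_itv/= ?andbT; last by apply/negP; rewrite -leNgt.
  (* When [x <= c] the inner exponential is at least 1. *)
  apply: (squeeze_cvgr (f := fun=> 0) (h := fun n : nat => expR (- n%:R))).
  + near=> n; rewrite expR_ge0/= ler_expR lerN2 ler_peMr//.
    rewrite leNgt expR_lt1 -leNgt oppr_ge0 mulr_ge0_le0// ?subr_le0//.
    by rewrite mulr_ge0// ltW.
  + exact: cvg_cst.
  + apply: (@cvg_comp _ _ _ (fun n => n%:R) (fun y : R => expR (- y)) _
        (pinfty_nbhs R)); [exact: cvgr_idn|exact: cvgr_expR].
Unshelve. all: by end_near. Qed.

(** Open rays are stable under intersection and generate the Borel sets. The sets whose indicator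
    lies in [S] form a Dynkin system: complements use the constant [x ^+ 0], disjoint unions use
    bounded limits. *)
Theorem test_indic (A : set R) : measurable A -> S (\1_A : R -> R).
Proof.
have GE : @measurable _ R = <<s @RGenOInfty.G R >>.
  exact: (RGenOInfty.measurableE R).
rewrite GE; move: A.
apply: (@dynkin_induction _ R _ (fun A => S (\1_A : R -> R))) => //.
- move=> _ _ [a ->] [b ->]; exists (Num.max a b).
  apply/seteqP; split=> x /=; rewrite !in_itv/= !andbT gt_max.
    by move=> [-> ->].
  by move=> /andP[].
- rewrite indicT (_ : cst 1 = fun x => x ^+ 0)//.
- by move=> _ [c ->]; exact: test_indic_itv.
- move=> A mA SA.
  rewrite (_ : \1_(~` A) = fun x => x ^+ 0 + (-1) * \1_A x).
    by apply: (test_add TS) => //; exact: (test_scale TS).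
  apply/funext => x; rewrite !indicE in_setC expr0.
  by case: (x \in A) => /=; lra.
- move=> F mF tF SF.
  (* By disjointness at most one term is nonzero at [x], so the partial sums are 0 or 1. *)
  have sumE k x n : F k x -> \sum_(0 <= i < n) \1_(F i) x = (k < n)%:R :> R.
    move=> Fkx; elim: n => [|n IH]; first by rewrite big_nil ltn0.
    rewrite big_nat_recr//= IH indicE.
    have -> : (x \in F n) = (k == n).
      apply/idP/eqP => [|<-]; last exact: mem_set.
      by rewrite inE => Fnx; apply: (tF k n) => //; exists x.
    by rewrite ltnS (leq_eqVlt k n) -natrD; case: ltngtP.
  have sumE0 x n : ~ (\bigcup_k F k) x ->
      \sum_(0 <= i < n) \1_(F i) x = 0 :> R.
    move=> Fx; apply: big1_seq => i _; rewrite indicE memNset//.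
    by apply: contra_not Fx => Fix; exists i.
  apply: (test_lim TS (f := fun n x => \sum_(0 <= i < n) \1_(F i) x) (C := 1)).
  + move=> n; apply: (test_sum TS) => [|i]; last exact: SF.
    exact: (test0 TS (Smon 0)).
  + by apply: measurable_indic; exact: bigcup_measurable.
  + move=> n x x0; rewrite mul1r; apply: le_trans (W_ge1 x0).
    have [[k _ Fkx]|Fx] := pselect ((\bigcup_k F k) x).
      by rewrite (sumE _ _ _ Fkx) ger0_norm// lern1 leq_b1.
    by rewrite sumE0// normr0.
  + move=> x x0; have [[k _ Fkx]|Fx] := pselect ((\bigcup_k F k) x).
      rewrite indicE mem_set; last by exists k.
      under eq_cvg do rewrite (sumE _ _ _ Fkx).
      apply: cvg_near_cst; near=> n; rewrite (_ : (k < n)%N)//.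
      by near: n; exact: nbhs_infty_gt.
    rewrite indicE memNset//; under eq_cvg do rewrite sumE0//.
    exact: cvg_cst.
Unshelve. all: by end_near. Qed.

End Determinacy.

(** * From indicators to dominated measurable functions *)

Section Extension.
Import HBNNSimple.
Context (R : realType) (W : R -> R) (S : (R -> R) -> Prop).
Hypothesis TS : test_class W S.
Hypothesis Sind : forall A : set R, measurable A -> S (\1_A : R -> R).

(** The simple functions increasing to [g] are finite combinations of indicators and are dominated
    by [g] itself. Since [W] is arbitrary here, a polynomial weight will do when no exponential
    moment is at hand. *)
Lemma test_ge0 (g : R -> R) (C : R) : measurable_fun [set: R] g ->
  (forall x, 0 <= x -> 0 <= g x) ->
  (forall x, 0 <= x -> g x <= C * W x) -> S g.
Proof.
move=> mg g0 gW.
(* The norm makes the approximated function nonnegative everywhere without changing [g] on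
   nonnegative reals. *)
have mg' : measurable_fun [set: R] (fun x => (`|g x|)%:E).
  by apply/measurable_EFinP; exact: measurableT_comp.
have g0' x : [set: R] x -> (0 <= (`|g x|)%:E)%E by rewrite lee_fin.
pose f n : R -> R := nnsfun_approx measurableT mg' n.
apply: (test_lim TS (f := f) (C := C)) => //.
- move=> n; rewrite (_ : f n = fun x => \sum_(y <- finmap.enum_fset (fset_set (range (f n))))
      y * \1_(f n @^-1` [set y]) x).
    apply: (test_sum TS).
      by rewrite -indic0; exact: Sind.
    move=> i; apply: (test_scale TS); apply: Sind.
    exact: measurable_funPTI.
  by apply/funext => x; rewrite {1}/f fimfunE fsbig_finite.
- move=> n x x0; apply: le_trans (gW _ x0).
  rewrite ger0_norm// /f nnsfun_approxE -[leRHS](ger0_norm (g0 _ x0)) -lee_fin.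
  exact: (le_approx n g0').
- move=> x x0; have := cvg_nnsfun_approx measurableT mg' g0' (x := x) I.
  move/fine_cvgP => -[_]; rewrite /= ger0_norm ?g0//.
Qed.

End Extension.

(** Compares the images under [V1] and [V2] of the measures with densities [D1] and [D2]. Allowing
    two spaces covers both uses: a law against a Lebesgue density, and [U] against a constant on one
    space. The domination clause makes both integrals converge, as linearity requires. *)
Definition same_integrals (R : realType) d1 d2 (T1 : measurableType d1)
    (T2 : measurableType d2) (m1 : {measure set T1 -> \bar R})
    (m2 : {measure set T2 -> \bar R}) (W : R -> R)
    (D1 V1 : T1 -> R) (D2 V2 : T2 -> R) (g : R -> R) : Prop :=
  [/\ measurable_fun [set: R] g,
      exists C : R, forall x, 0 <= x -> `|g x| <= C * W x &
      \int[m1]_w (D1 w * g (V1 w)) = \int[m2]_w (D2 w * g (V2 w))].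

(** * Integrals against a density, under a weight *)

Section Weighted.
Context (R : realType) d (T : measurableType d) (m : {measure set T -> \bar R}).
Variables (W : R -> R) (D V : T -> R).
Hypotheses (mD : measurable_fun [set: T] D) (mV : measurable_fun [set: T] V).
Hypothesis V_ge0 : {ae m, forall w, 0 <= V w}.
Hypothesis DW : m.-integrable [set: T] (EFin \o (fun w => D w * W (V w))).

Lemma measurable_weighted (g : R -> R) : measurable_fun [set: R] g ->
  measurable_fun [set: T] (fun w => D w * g (V w)).
Proof. by move=> mg; apply: measurable_funM => //; exact: measurableT_comp. Qed.

Lemma integrable_bound (C : R) : m.-integrable [set: T]
  (EFin \o (fun w => `|C| * `|D w * W (V w)|)).
Proof. by apply: integrableZ_EFin; exact: (integrable_norm DW). Qed.

Lemma weighted_le (g : R -> R) (C : R) w :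
  (forall x, 0 <= x -> `|g x| <= C * W x) -> 0 <= V w ->
  `|D w * g (V w)| <= `|C| * `|D w * W (V w)|.
Proof.
move=> gW V0; rewrite !normrM mulrCA ler_wpM2l//.
by rewrite -normrM; apply: le_trans (gW _ V0) (ler_norm _).
Qed.

Lemma integrable_weighted (g : R -> R) (C : R) : measurable_fun [set: R] g ->
  (forall x, 0 <= x -> `|g x| <= C * W x) ->
  m.-integrable [set: T] (EFin \o (fun w => D w * g (V w))).
Proof.
move=> mg gW; apply: ae_le_integrable (integrable_bound C).
  exact: measurable_weighted.
by move: V_ge0; apply: filterS => w; exact: weighted_le.
Qed.

Lemma cvg_weighted (f : (R -> R)^nat) (g : R -> R) (C : R) :
  (forall n, measurable_fun [set: R] (f n)) -> measurable_fun [set: R] g ->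
  (forall n x, 0 <= x -> `|f n x| <= C * W x) ->
  (forall x, 0 <= x -> f ^~ x @ \oo --> g x) ->
  (fun n => \int[m]_w (D w * f n (V w))) @ \oo --> \int[m]_w (D w * g (V w)).
Proof.
move=> mf mg fW fg.
apply: (Rdominated_convergence _ _ _ _ (integrable_bound C)).
- by move=> n; exact: measurable_weighted.
- exact: measurable_weighted.
- by move: V_ge0; apply: filterS => w w0; apply: cvgMr; exact: fg.
- by move: V_ge0; apply: filterS => w w0 n; apply: weighted_le w0; exact: fW.
Qed.

End Weighted.

(** Sums and multiples are handled by linearity, limits by dominated convergence on each side and
    uniqueness of the limit. *)
Lemma same_integrals_test (R : realType) d1 d2 (T1 : measurableType d1)
    (T2 : measurableType d2) (m1 : {measure set T1 -> \bar R})
    (m2 : {measure set T2 -> \bar R}) (W : R -> R)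
    (D1 V1 : T1 -> R) (D2 V2 : T2 -> R) :
  measurable_fun [set: T1] D1 -> measurable_fun [set: T1] V1 ->
  {ae m1, forall w, 0 <= V1 w} ->
  m1.-integrable [set: T1] (EFin \o (fun w => D1 w * W (V1 w))) ->
  measurable_fun [set: T2] D2 -> measurable_fun [set: T2] V2 ->
  {ae m2, forall w, 0 <= V2 w} ->
  m2.-integrable [set: T2] (EFin \o (fun w => D2 w * W (V2 w))) ->
  test_class W (same_integrals m1 m2 W D1 V1 D2 V2).
Proof.
move=> mD1 mV1 V10 DW1 mD2 mV2 V20 DW2; split.
- move=> f g [mf [C1 fC] ef] [mg [C2 gC] eg]; split.
  + exact: measurable_funD.
  + exists (C1 + C2) => x x0; rewrite mulrDl (le_trans (ler_normD _ _))//.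
    by rewrite lerD ?fC ?gC.
  + under eq_Rintegral do rewrite mulrDr.
    under [RHS]eq_Rintegral do rewrite mulrDr.
    by rewrite !RintegralD ?ef ?eg//; apply: integrable_weighted; eauto.
- move=> a g [mg [C gC] eg]; split.
  + exact: measurable_funM.
  + exists (`|a| * C) => x x0; rewrite normrM -mulrA ler_wpM2l//.
    exact: gC.
  + under eq_Rintegral do rewrite mulrCA.
    under [RHS]eq_Rintegral do rewrite mulrCA.
    by rewrite !RintegralZl ?eg//; apply: integrable_weighted; eauto.
- move=> f g C Sf mg fW fg; split => //.
  + exists C => x x0; have /cvg_norm c := fg _ x0.
    rewrite -(cvg_lim _ c)//; apply: limr_le; first exact: cvgP c.
    by apply: nearW => n; exact: fW.
  + have mf n : measurable_fun [set: R] (f n) by case: (Sf n).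
    have c1 := cvg_weighted mD1 mV1 V10 DW1 mf mg fW fg.
    have c2 := cvg_weighted mD2 mV2 V20 DW2 mf mg fW fg.
    move: c2; rewrite (_ : (fun n => _) = fun n =>
      \int[m1]_w (D1 w * f n (V1 w))).
      exact: (cvg_unique _ c1).
    by apply/funext => n; case: (Sf n).
Qed.

(** * Moments of the exponential law *)

(** At the rate [(2 * mu)^-1] the term of index [j] in the exponential series has integral at most
    [2^-1 ^+ j]; monotone convergence then bounds the whole integral by 2. *)
Lemma integrable_expR_moments d (T : measurableType d) (R : realType)
    (m : {measure set T -> \bar R}) (V : T -> R) (mu : R) :
  measurable_fun [set: T] V -> (forall w, 0 <= V w) -> 0 < mu ->
  (forall n, m.-integrable [set: T] (EFin \o (fun w => V w ^+ n))) ->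
  (forall n, \int[m]_w (V w ^+ n) <= n`!%:R * mu ^+ n) ->
  m.-integrable [set: T] (EFin \o (fun w => expR ((2 * mu)^-1 * V w))).
Proof.
move=> mV V0 mu0 iV leV; set s := (2 * mu)^-1.
have s0 : 0 < s by rewrite invr_gt0 mulr_gt0.
pose f N w := series (exp_coeff (s * V w)) N.
have fE N : f N = fun w => \sum_(0 <= j < N) s ^+ j / j`!%:R * V w ^+ j.
  apply/funext => w; rewrite /f /series/=; apply: eq_bigr => j _.
  by rewrite /exp_coeff/= exprMn mulrAC.
have mf N : measurable_fun [set: T] (f N).
  rewrite fE; apply: measurable_sum => j; apply: measurable_funM => //.
  exact: measurable_funX.
have f0 N w : 0 <= f N w.
  by apply: sumr_ge0 => j _; apply: exp_coeff_ge0; rewrite mulr_ge0// ltW.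
have iterm j : m.-integrable [set: T] (EFin \o (fun w => s ^+ j / j`!%:R * V w ^+ j)).
  exact: integrableZ_EFin.
have intf N : (\int[m]_w (f N w)%:E <= 2%:E)%E.
  have iF : m.-integrable [set: T] (EFin \o f N).
    by rewrite fE; exact: integrable_sum_EFin.
  rewrite -(fineK (integrable_fin_num measurableT iF)) lee_fin -/(Rintegral _ _ _).
  rewrite fE Rintegral_sum//.
  apply: (@le_trans _ _ (\sum_(0 <= j < N) 2^-1 ^+ j)).
    apply: ler_sum => j _; rewrite RintegralZl//.
    have -> : 2^-1 ^+ j = s ^+ j / j`!%:R * (j`!%:R * mu ^+ j).
      rewrite -mulrA mulKf ?pnatr_eq0 -?lt0n ?fact_gt0// -exprMn; congr (_ ^+ j).
      by rewrite /s; field; rewrite gt_eqF.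
    by rewrite ler_wpM2l// divr_ge0// exprn_ge0// ltW.
  rewrite big_mkord; have := subrX1 (2^-1 : R) N.
  have : 0 <= 2^-1 ^+ N :> R by rewrite exprn_ge0.
  lra.
apply/integrableP; split.
  by apply/measurable_EFinP; apply: measurableT_comp => //; exact: measurable_funM.
rewrite (eq_integral (fun w => limn (fun N => (f N w)%:E))); last first.
  move=> w _ /=; rewrite ger0_norm ?expR_ge0//; apply/esym/cvg_lim => //.
  by apply: cvg_EFin; [exact: nearW|exact: is_cvg_series_exp_coeff].
rewrite monotone_convergence//.
- apply: (@le_lt_trans _ _ 2%:E); last exact: ltry.
  apply: lime_le; last by apply: nearW.
  apply: ereal_nondecreasing_is_cvgn => a b ab; apply: ge0_le_integral => //.
  + by move=> w _; rewrite lee_fin.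
  + exact/measurable_EFinP.
  + exact/measurable_EFinP.
  + move=> w _; rewrite lee_fin /f /series/=.
    rewrite [leRHS](big_cat_nat (n := a))//= lerDl.
    by apply: sumr_ge0 => j _; apply: exp_coeff_ge0; rewrite mulr_ge0// ltW.
- by move=> n; exact/measurable_EFinP.
- by move=> n w _; rewrite lee_fin.
- move=> w _ a b ab; rewrite lee_fin /f /series/=.
  rewrite [leRHS](big_cat_nat (n := a))//= lerDl.
  by apply: sumr_ge0 => j _; apply: exp_coeff_ge0; rewrite mulr_ge0// ltW.
Qed.

(** * Moments of the exponential density *)

Section ExponentialMoments.
Context (R : realType) (r : R).
Hypothesis r_gt0 : 0 < r.
Local Notation leb := (@lebesgue_measure R).

(** The primitive of [r * (x ^+ n * expR (- r * x))] that vanishes at infinity, obtained by repeated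
    integration by parts. *)
Fixpoint exponential_primitive n (x : R) : R :=
  if n is n'.+1 then
    - (x ^+ n * expR (- r * x)) + n%:R / r * exponential_primitive n' x
  else - expR (- r * x).

Lemma is_derive_exprn n (x : R) :
  is_derive x 1 (fun x : R => x ^+ n) (n%:R * x ^+ n.-1).
Proof.
apply: DeriveDef; first exact: exprn_derivable.
by rewrite exp_derive /GRing.scale/= mulr1.
Qed.

Lemma is_derive_expRM (x : R) :
  is_derive x 1 (fun x : R => expR (- r * x)) (- r * expR (- r * x)).
Proof.
have h : is_derive x 1 (fun x : R => - r * x) (- r).
  by apply: is_derive_eq; rewrite /GRing.scale/= mulr1.
by apply: (is_derive_eq (is_derive1_comp _ h)); rewrite mulrC.
Qed.

Lemma is_derive_exponential_primitive n (x : R) :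
  is_derive x 1 (exponential_primitive n) (r * (x ^+ n * expR (- r * x))).
Proof.
have dE := is_derive_expRM x.
elim: n => [|n IH].
  apply: (is_derive_eq (is_deriveN dE)).
  by rewrite expr0 mul1r mulNr opprK.
have dX := is_derive_exprn n.+1 x.
apply: (is_derive_eq (is_deriveD (is_deriveN (is_deriveM dX dE))
  (is_deriveZ (n.+1%:R / r) IH))).
rewrite /GRing.scale/= exprS; field; by rewrite gt_eqF.
Qed.

Lemma exponential_primitive0 n :
  exponential_primitive n 0 = - (n`!%:R / r ^+ n).
Proof.
elim: n => [|n IH] /=; first by rewrite mulr0 expR0 fact0 expr0 divr1.
rewrite IH expr0n/= mul0r oppr0 add0r factS natrM exprS invfM.
by ring.
Qed.

(** Using [exprn_le_expR] with exponent [n.+1] leaves a spare factor [x^-1]. *)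
Lemma exprn_expRN_cvg0 n : (x ^+ n * expR (- r * x)) @[x --> +oo] --> (0 : R).
Proof.
apply: (squeeze_cvgr (f := fun=> 0)
  (h := fun x => (n.+1)`!%:R / r ^+ n.+1 * x^-1)).
- near=> x; have x0 : 0 < x by near: x; exact: nbhs_pinfty_gt.
  rewrite mulr_ge0 ?expR_ge0 ?exprn_ge0 ?(ltW x0)//=.
  rewrite mulNr expRN ler_pdivrMr ?expR_gt0// mulrAC ler_pdivlMr//.
  rewrite -exprSr mulrAC ler_pdivlMr ?exprn_gt0// -exprMn (mulrC x r).
  by apply: exprn_le_expR; rewrite mulr_ge0// ltW.
- exact: cvg_cst.
- rewrite -[X in _ --> X](mulr0 ((n.+1)`!%:R / r ^+ n.+1)); apply: cvgMr.
  apply/gtr0_cvgV0; last exact: cvg_id.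
  exact: nbhs_pinfty_gt.
Unshelve. all: by end_near. Qed.

Lemma exponential_primitive_cvg0 n :
  exponential_primitive n x @[x --> +oo] --> (0 : R).
Proof.
elim: n => [|n IH] /=.
  rewrite -oppr0; apply: cvgN.
  have := @exprn_expRN_cvg0 0; under eq_fun do rewrite expr0 mul1r; exact.
rewrite -[X in _ --> X]addr0; apply: cvgD.
  rewrite -oppr0; apply: cvgN; exact: (exprn_expRN_cvg0 n.+1).
by rewrite -[X in _ --> X](mulr0 (n.+1%:R / r)); apply: cvgMr.
Qed.

(** The density vanishes on negative reals; on the half-line the norm disappears and the integral is
    minus the value at 0 of [exponential_primitive]. *)
Lemma integral_exponential_pdf_moment n :
  (\int[leb]_x (exponential_pdf r x * `|x| ^+ n)%:E = (n`!%:R / r ^+ n)%:E)%E.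
Proof.
pose f (x : R) := r * (x ^+ n * expR (- r * x)).
have cf : continuous f.
  move=> x; have h : derivable f x 1.
    apply: ex_derive.
    exact: (is_deriveZ r (is_deriveM (is_derive_exprn n x) (is_derive_expRM x))).
  exact/differentiable_continuous/derivable1_diffP.
transitivity (\int[leb]_(x in `[0%R, +oo[) (f x)%:E)%E.
  rewrite [RHS]integral_mkcond; apply: eq_integral => x _.
  rewrite patchE; have [x0|x0] := leP 0 x.
    rewrite mem_set/= ?in_itv/= ?x0// exponential_pdfE// ger0_norm// /f.
    by congr (_%:E); ring.
  rewrite memNset/= ?in_itv/= ?andbT; last by apply/negP; rewrite -ltNge.
  by rewrite lt0_exponential_pdf// mul0r.
rewrite (@ge0_continuous_FTC2y _ f (exponential_primitive n) _ 0)//.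
- by rewrite exponential_primitive0 EFinN oppeK add0e.
- move=> x x0; rewrite /f !mulr_ge0 ?expR_ge0 ?exprn_ge0// ltW//.
- exact: continuous_subspaceT.
- exact: exponential_primitive_cvg0.
- by move=> x _; apply: ex_derive; exact: is_derive_exponential_primitive.
- apply/cvg_at_right_filter/differentiable_continuous/derivable1_diffP.
  by apply: ex_derive; exact: is_derive_exponential_primitive.
- move=> x _; rewrite derive1E.
  by have [_ ->] := is_derive_exponential_primitive n x.
Qed.

(** Half of the rate survives: the product is twice the density of rate [r / 2]. *)
Lemma integrable_exponential_pdf_expR :
  leb.-integrable [set: R]
    (EFin \o (fun x => exponential_pdf r x * expR (2^-1 * r * `|x|))).
Proof.
have r20 : 0 < r / 2 by rewrite divr_gt0.
rewrite (_ : (fun _ => _) = fun x => 2 * exponential_pdf (r / 2) x).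
  by apply: integrableZ_EFin; exact: integrable_exponential_pdf.
apply/funext => x; have [x0|x0] := leP 0 x; last first.
  by rewrite !lt0_exponential_pdf// mul0r mulr0.
rewrite !exponential_pdfE// ger0_norm// -mulrA -expRD.
rewrite (_ : - r * x + _ = - (r / 2) * x); last by field.
by field.
Qed.

End ExponentialMoments.

(** * Independence *)

Section IndependentProduct.
Context d d1 d2 (T : measurableType d) (T1 : measurableType d1)
  (T2 : measurableType d2) (R : realType) (P : probability T R).
Variables (A : {mfun T >-> T1}) (B : {mfun T >-> T2}).
Hypothesis indepAB : indep_rv P A B.
Variables (g : T1 -> R) (h : T2 -> R).
Hypotheses (mg : measurable_fun [set: T1] g) (mh : measurable_fun [set: T2] h).
Hypothesis ig : P.-integrable [set: T] (EFin \o (fun w => g (A w))).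
Hypothesis ih : P.-integrable [set: T] (EFin \o (fun w => h (B w))).

Let mA : measurable_fun [set: T] A. Proof. exact: measurable_funP. Qed.
Let mB : measurable_fun [set: T] B. Proof. exact: measurable_funP. Qed.

Let mAB : measurable_fun [set: T] (fun w => (A w, B w)).
Proof. exact: measurable_fun_pair. Qed.

Let AB : {mfun T >-> (T1 * T2)%type} :=
  HB.pack (fun w => (A w, B w)) (isMeasurableFun.Build _ _ _ _ _ mAB).

(** Independence is agreement with the product measure on rectangles, which determine it. *)
Let joint_law (Z : set (T1 * T2)) : measurable Z ->
  (distribution P A \x distribution P B)%E Z = distribution P AB Z.
Proof.
apply: product_measure_unique => U V mU mV.
by rewrite /distribution /pushforward -(indepAB mU mV).
Qed.

Let f (z : T1 * T2) : R := g z.1 * h z.2.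

Let mf : measurable_fun [set: (T1 * T2)%type] f.
Proof. by apply: measurable_funM; apply: measurableT_comp. Qed.

Let mgE : measurable_fun [set: T1] (EFin \o g). Proof. exact/measurable_EFinP. Qed.
Let mhE : measurable_fun [set: T2] (EFin \o h). Proof. exact/measurable_EFinP. Qed.
Let mfE : measurable_fun [set: (T1 * T2)%type] (EFin \o f).
Proof. exact/measurable_EFinP. Qed.

Let ig' : (distribution P A).-integrable [set: T1] (EFin \o g).
Proof. by apply: integrable_pushforward. Qed.

Let ih' : (distribution P B).-integrable [set: T2] (EFin \o h).
Proof. by apply: integrable_pushforward. Qed.

Let integrable_f :
  (distribution P A \x distribution P B)%E.-integrable [set: (T1 * T2)%type]
    (EFin \o f).
Proof.
apply/integrable12ltyP => //.
have /integrableP[_ gfin] := ig'; have /integrableP[_ hfin] := ih'.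
set c := (\int[distribution P B]_y `|(EFin \o h) y|)%E in hfin.
have c0 : (0 <= c)%E by exact: integral_ge0.
have inner x : (\int[distribution P B]_y `|(EFin \o f) (x, y)| =
    `|(EFin \o g) x| * c)%E.
  rewrite -ge0_integralZl//; last exact: measurableT_comp.
  by apply: eq_integral => y _; rewrite /= normrM EFinM.
rewrite (eq_integral (fun x => `|(EFin \o g) x| * c)%E); last first.
  by move=> x _; exact: inner.
rewrite ge0_integralZr//; last exact: measurableT_comp.
apply: lte_mul_pinfty => //; first exact: integral_ge0.
by rewrite ge0_fin_numE//; exact: integral_ge0.
Qed.

Let integral_law (k : T1 * T2 -> \bar R) :
  (\int[distribution P A \x distribution P B]_z k z =
   \int[distribution P AB]_z k z)%E.
Proof. by apply: eq_measure_integral => Z mZ _; exact: joint_law. Qed.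

(** Tonelli under the product of the two laws. Arbitrary value spaces allow one of the variables to
    be a pair. *)
Lemma indep_integrableM :
  P.-integrable [set: T] (EFin \o (fun w => g (A w) * h (B w))).
Proof.
have /integrableP[_ ffin] := integrable_f.
apply/integrableP; split.
  apply/measurable_EFinP; exact: (measurableT_comp mf mAB).
move: ffin; rewrite integral_law ge0_integral_distribution//.
exact: measurableT_comp.
Qed.

Lemma indep_RintegralM : \int[P]_w (g (A w) * h (B w)) =
  \int[P]_w (g (A w)) * \int[P]_w (h (B w)).
Proof.
have ihf := integrable_fin_num measurableT ih'.
rewrite /Rintegral -fineM; [|exact: integrable_fin_num..].
congr fine.
transitivity (\int[distribution P AB]_z (EFin \o f) z)%E.
  by rewrite integral_distribution//; exact: indep_integrableM.
rewrite -integral_law -integral12_prod_meas1//.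
transitivity (\int[distribution P A]_x ((EFin \o g) x *
    \int[distribution P B]_y (EFin \o h) y))%E.
  apply: eq_integral => x _; rewrite -(integralZl measurableT ih' (g x)).
  by apply: eq_integral => y _.
rewrite -(fineK ihf) integralZr// (fineK ihf).
by rewrite !integral_distribution.
Qed.

End IndependentProduct.

(** * The moment recursion *)

Section MomentRecursion.
Context (R : realFieldType) (p q : R).
Hypotheses (p_gt0 : 0 < p) (q_gt0 : 0 < q) (pq1 : p + q = 1).
Implicit Types (m : nat -> R) (mu : R).

(* [E(X^a (qX + Y)^n)] for i.i.d. [X] and [Y] with moments [m]. *)
Definition mixed_moment m a n : R :=
  \sum_(i < n.+1) (q ^+ (n - i) *+ 'C(n, i)) * (m (n - i + a)%N * m i).

(** [E(U V^n)], split over the Bernoulli variable: value 1 gives [U = pX] and [V = qX + Y], value 0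
    gives [U = pX + Y] and [V = qX]. [V_moment] splits [E(V^n)] in the same way. *)
Definition UV_moment m n : R :=
  p * (p * mixed_moment m 1 n) + q * (p * (q ^+ n * m n.+1) + q ^+ n * (m n * m 1%N)).

Definition V_moment m n : R := p * mixed_moment m 0 n + q * (q ^+ n * m n).

Definition exp_moment mu n : R := n`!%:R * mu ^+ n.

(** After reversing the sum, the binomial coefficient cancels the factorials up to a falling
    factorial, which is 1 for [a = 0] and [j.+1] for [a = 1]. *)
Lemma mixed_moment_exp mu a n : mixed_moment (exp_moment mu) a n =
  n`!%:R * mu ^+ (n + a) * \sum_(j < n.+1) ((j + a)%N ^_ a)%:R * q ^+ j.
Proof.
rewrite /mixed_moment (reindex_inj rev_ord_inj)/= mulr_sumr.
apply: eq_bigr => j _; rewrite subSS subKn ?leq_ord//.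
have jn : (j <= n)%N by rewrite -ltnS.
rewrite bin_sub// /exp_moment -mulr_natl.
have -> : n`!%:R = 'C(n, j)%:R * (j`!%:R * (n - j)`!%:R) :> R.
  by rewrite -!natrM bin_fact.
have -> : (n + a = (j + a) + (n - j))%N by rewrite addnAC subnKC.
have -> : (j + a)`!%:R = ((j + a) ^_ a)%:R * j`!%:R :> R.
  by rewrite -natrM -{3}(addnK a j) ffact_fact// leq_addl.
by rewrite (exprD mu (j + a)%N (n - j)%N); ring.
Qed.

(** Summation by parts, with [p = 1 - q]. *)
Lemma sum_geometric_deriv n :
  p * (\sum_(j < n.+1) j.+1%:R * q ^+ j) + n.+1%:R * q ^+ n.+1 =
  \sum_(j < n.+1) q ^+ j.
Proof.
have pE : p = 1 - q by rewrite -pq1 addrK.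
elim: n => [|n IH].
  by rewrite !big_ord_recr !big_ord0/= !expr0 expr1 pE; ring.
rewrite big_ord_recr/= [RHS]big_ord_recr/= -IH mulrDr.
by rewrite -[n.+2%:R]natr1 !exprS pE; ring.
Qed.

(** Once [n! mu^(n+1)] is factored out and [q ^+ n.+1] cancelled, this is [p] times
    [sum_geometric_deriv]. *)
Lemma UV_moment_exp mu n :
  UV_moment (exp_moment mu) n = mu * V_moment (exp_moment mu) n.
Proof.
rewrite /UV_moment /V_moment !mixed_moment_exp.
under eq_bigr do rewrite addn1 ffactn1.
under [in RHS]eq_bigr do rewrite ffactn0 mul1r.
rewrite -(sum_geometric_deriv n) /exp_moment addn0 addn1 (factS n) natrM.
by rewrite (_ : 1`! = 1)%N// expr1 (exprS mu n) (exprS q n); ring.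
Qed.

Lemma UV_moment0 m : m 0%N = 1 -> UV_moment m 0 = m 1%N.
Proof.
move=> m0.
rewrite /UV_moment /mixed_moment big_ord_recl big_ord0 /= bin0 subn0 !expr0 m0.
have -> : p = 1 - q by rewrite -pq1 addrK.
by ring.
Qed.

Lemma V_moment0 m : m 0%N = 1 -> V_moment m 0 = 1.
Proof.
move=> m0.
rewrite /V_moment /mixed_moment big_ord_recl big_ord0 /= bin0 subn0 !expr0 m0.
by rewrite -[RHS]pq1; ring.
Qed.

(** By [UV_moment_exp] both sequences solve the same recursion. In the equation of index [n] the
    moment of order [n.+1] has total coefficient [p * p * q ^+ n + q * p * q ^+ n = p * q ^+ n],
    which is nonzero, and all other moments have order at most [n]. *)
Lemma exp_moment_unique m : m 0%N = 1 ->
  (forall n, UV_moment m n = m 1%N * V_moment m n) ->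
  forall n, m n = exp_moment (m 1%N) n.
Proof.
move=> m0 rec n; set mu := m 1%N; set e := exp_moment mu.
suff : forall k, (k <= n)%N -> m k = e k by exact.
have e0 : e 0%N = 1 by rewrite /e /exp_moment fact0 expr0 mulr1.
have e1 : e 1%N = mu by rewrite /e /exp_moment expr1 mul1r.
elim: n => [|n IH] k; first by rewrite leqn0 => /eqP ->; rewrite m0.
rewrite leq_eqVlt ltnS => /orP[/eqP ->|]; last exact: IH.
(* The term of index 0 is split off: for [a = 1] it alone contains order [n.+1], and the others
   cancel by induction. *)
have mixE a : mixed_moment m a n - mixed_moment e a n =
    q ^+ n * (m (n + a)%N - e (n + a)%N) +
    \sum_(i < n) (q ^+ (n - i.+1) *+ 'C(n, i.+1)) *
       (m (n - i.+1 + a)%N * m i.+1 - e (n - i.+1 + a)%N * e i.+1).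
  rewrite /mixed_moment !big_ord_recl/= subn0 bin0 m0 e0.
  rewrite [X in _ = _ + X](_ : _ =
    \sum_(i < n) (q ^+ (n - i.+1) *+ 'C(n, i.+1)) * (m (n - i.+1 + a)%N * m i.+1) -
    \sum_(i < n) (q ^+ (n - i.+1) *+ 'C(n, i.+1)) * (e (n - i.+1 + a)%N * e i.+1)).
    by rewrite /bump/=; ring.
  by rewrite -sumrB; apply: eq_bigr => i _; rewrite mulrBr.
have mix1 : mixed_moment m 1 n - mixed_moment e 1 n = q ^+ n * (m n.+1 - e n.+1).
  rewrite mixE addn1 big1 ?addr0// => i _.
  by rewrite !IH ?subrr ?mulr0//; have := ltn_ord i; lia.
have mix0 : mixed_moment m 0 n - mixed_moment e 0 n = 0.
  rewrite mixE addn0 big1 ?addr0; first by rewrite IH// subrr mulr0.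
  by move=> i _; rewrite !IH ?subrr ?mulr0//; have := ltn_ord i; lia.
have := rec n; have := UV_moment_exp mu n; rewrite -/e /UV_moment /V_moment e1 -/mu.
rewrite (IH n)// => re rm.
have : p * q ^+ n * (m n.+1 - e n.+1) = 0.
  have qE : p = 1 - q by rewrite -pq1 addrK.
  have := congr2 (fun x y => x - y) rm re.
  rewrite (subr0_eq mix0).
  have -> : mixed_moment m 1 n = mixed_moment e 1 n + q ^+ n * (m n.+1 - e n.+1).
    by rewrite -mix1; ring.
  rewrite subrr => H; rewrite -[RHS]H qE; ring.
move/eqP; rewrite mulf_eq0 subr_eq0 => /orP[|/eqP//].
by rewrite gt_eqF// mulr_gt0// exprn_gt0.
Qed.

End MomentRecursion.

(** * Characterization of the exponential law *)

Lemma exprn_le_expRM (R : realType) (a x : R) k : 0 < a -> 0 <= x ->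
  `|x ^+ k| <= k`!%:R / a ^+ k * expR (a * x).
Proof.
move=> a0 x0; rewrite ger0_norm ?exprn_ge0// mulrAC ler_pdivlMr ?exprn_gt0//.
by rewrite -exprMn mulrC exprn_le_expR// mulr_ge0// ltW.
Qed.

Lemma integral_indic_comp d (T : measurableType d) (R : realType)
    (m : {measure set T -> \bar R}) (D V : T -> R) (A : set R) :
  \int[m]_w (D w * \1_A (V w)) = \int[m]_(w in V @^-1` A) D w.
Proof. by rewrite [RHS]Rintegral_mkcond; apply: eq_Rintegral => w _; rewrite patch_indic. Qed.

(** * The exponential law and its moment sequence *)

Section ExponentialLaw.
Context d (T : measurableType d) (R : realType) (P : probability T R).
Variable X : {RV P >-> R}.
Hypothesis X_gt0 : {ae P, forall w, 0 < X w}.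
Hypothesis momX : forall n : nat, P.-integrable [set: T] (fun w => (X w ^+ n)%:E).
Variable mu : R.
Hypothesis mu_gt0 : 0 < mu.

Let mX : measurable_fun [set: T] X. Proof. exact: measurable_funP. Qed.

Let X_ge0 : {ae P, forall w, 0 <= X w}.
Proof. by move: X_gt0; apply: filterS => w w0; exact: ltW. Qed.

Local Notation leb := (@lebesgue_measure R).
Local Notation pdf := (exponential_pdf mu^-1).
(* The norm makes the variable on the Lebesgue side nonnegative; it is harmless
   because [pdf] vanishes on negative reals. *)
Let compared W := same_integrals P leb W (cst 1) X pdf (@Num.norm R R).

Let mpdf : measurable_fun [set: R] pdf. Proof. exact: measurable_exponential_pdf. Qed.

(** [integrable_expR_moments] asks for nonnegativity everywhere, so it is applied to the norm of
    [X], almost surely equal to [X]. *)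
Lemma integrable_expR_RV :
  (forall n, \int[P]_w (X w ^+ n) = exp_moment mu n) ->
  P.-integrable [set: T] (EFin \o (fun w => expR ((2 * mu)^-1 * X w))).
Proof.
move=> mE.
have mabs : measurable_fun [set: T] (fun w => `|X w|) by exact: measurableT_comp.
have absX n : {ae P, forall w, `|X w| ^+ n = X w ^+ n}.
  by move: X_ge0; apply: filterS => w w0; rewrite ger0_norm.
have mXn n : measurable_fun [set: T] (fun w => X w ^+ n) by exact: measurable_funX.
have mXn' n : measurable_fun [set: T] (fun w => `|X w| ^+ n) by exact: measurable_funX.
have := @integrable_expR_moments _ _ _ P (fun w => `|X w|) mu mabs
  (fun w => normr_ge0 _) mu_gt0.
move=> H; apply: ae_eq_integrable (H _ _).
- by apply: measurableT_comp => //; exact: measurable_funM.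
- by move: X_ge0; apply: filterS => w w0; rewrite ger0_norm.
- by move=> n; exact: ae_eq_integrable (momX n).
- by move=> n; rewrite (ae_eq_Rintegral _ _ (absX n))// mE.
Qed.

(** Both values are finite, so equality of the real integrals lifts to the extended reals; [1 <= W]
    dominates the indicator. *)
Lemma compared_indic W (A : set R) : measurable A ->
  (forall x, 0 <= x -> 1 <= W x) ->
  compared W (\1_A) <-> distribution P X A = exponential_prob mu^-1 A.
Proof.
move=> mA W1.
have e1 : \int[P]_w (cst 1 w * \1_A (X w)) = fine (distribution P X A).
  rewrite integral_indic_comp Rintegral_cst ?mul1r//.
  by rewrite -[X in measurable X]setTI; exact: mX.
have e2 : \int[leb]_x (pdf x * \1_A `|x|) = fine (exponential_prob mu^-1 A).
  rewrite -[RHS]/(\int[leb]_(x in id @^-1` A) pdf x) -integral_indic_comp.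
  apply: eq_Rintegral => x _; have [x0|x0] := leP 0 x; first by rewrite ger0_norm.
  by rewrite lt0_exponential_pdf// !mul0r.
have r0 : 0 < mu^-1 by rewrite invr_gt0.
have f1 : distribution P X A \is a fin_num by exact: fin_num_measure.
have f2 : exponential_prob mu^-1 A \is a fin_num.
  have iA : leb.-integrable A (EFin \o pdf).
    by apply: integrableS (integrable_exponential_pdf r0).
  by apply: (integrable_fin_num _ iA); exact: mA.
split=> [[_ _]|eA].
  by rewrite e1 e2 => eA; rewrite -(fineK f1) -(fineK f2) eA.
split; [exact: measurable_indic| |by rewrite e1 e2 eA].
exists 1 => x x0; rewrite mul1r (le_trans _ (W1 _ x0))//.
by rewrite indicE; case: (_ \in _); rewrite ?normr1 ?normr0.
Qed.

Let ae_norm : {ae leb, forall x : R, 0 <= `|x|}.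
Proof. by apply: aeW => x. Qed.

Lemma integrable_pdf_moment n :
  leb.-integrable [set: R] (EFin \o (fun x => pdf x * `|x| ^+ n)).
Proof.
have r0 : 0 < mu^-1 by rewrite invr_gt0.
apply/integrableP; split.
  apply/measurable_EFinP; apply: measurable_funM => //.
  by apply: measurable_funX; exact: normr_measurable.
have pdf0 x : 0 <= pdf x * `|x| ^+ n.
  by rewrite mulr_ge0// exponential_pdf_ge0// ltW.
under eq_integral do rewrite /= ger0_norm//.
by rewrite integral_exponential_pdf_moment// ltry.
Qed.

Lemma Rintegral_pdf_moment n :
  \int[leb]_x (pdf x * `|x| ^+ n) = exp_moment mu n.
Proof.
rewrite /Rintegral integral_exponential_pdf_moment ?invr_gt0//=.
by rewrite exprVn invrK.
Qed.

Lemma exponential_of_moments :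
  (forall n, \int[P]_w (X w ^+ n) = exp_moment mu n) ->
  exponentially_distributed X.
Proof.
move=> mE; exists mu => // A mA.
have r0 : 0 < mu^-1 by rewrite invr_gt0.
(* The weight becomes [expR ((2 * mu)^-1 * x)]: the rate given by the moments of [X], and half the
   rate of the density. *)
pose h := (4 * mu)^-1.
have h0 : 0 < h by rewrite invr_gt0 mulr_gt0.
have h2 : 2 * h = (2 * mu)^-1 by rewrite /h; field; rewrite gt_eqF.
pose W x := expR (2 * h * x).
apply/(@compared_indic W) => //.
  by move=> x x0; rewrite /W leNgt expR_lt1 -leNgt !mulr_ge0// ltW.
apply: (test_indic h0) => //.
  apply: same_integrals_test => //.
  - rewrite /W h2; apply: ae_eq_integrable (integrable_expR_RV mE).
      by apply: measurable_funM => //; apply: measurableT_comp => //; exact: measurable_funM.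
    by apply: aeW => w; rewrite mul1r.
  - have := integrable_exponential_pdf_expR r0; rewrite /W h2 invfM//.
move=> k; split => //.
- by exists (k`!%:R / (2 * h) ^+ k) => x x0; apply: exprn_le_expRM => //; rewrite mulr_gt0.
- rewrite Rintegral_pdf_moment -mE; apply: eq_Rintegral => w _.
  by rewrite mul1r.
Qed.

(** Equal laws agree on indicators, hence on powers by [test_ge0]. The weight [1 + x ^+ n] dominates
    both kinds of function and is integrable on each side. *)
Lemma moments_of_exponential :
  (forall A : set R, measurable A ->
     distribution P X A = exponential_prob mu^-1 A) ->
  forall n, \int[P]_w (X w ^+ n) = exp_moment mu n.
Proof.
move=> lawX n; pose W (x : R) := 1 + x ^+ n.
have TW : test_class W (compared W).
  apply: same_integrals_test => //.
  - rewrite (_ : (fun _ => _) = fun w => X w ^+ 0 + X w ^+ n).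
      by apply: integrableD_EFin; exact: momX.
    by apply/funext => w; rewrite mul1r.
  - rewrite (_ : (fun _ => _) = fun x => pdf x * `|x| ^+ 0 + pdf x * `|x| ^+ n).
      by apply: integrableD_EFin; exact: integrable_pdf_moment.
    by apply/funext => x; rewrite /W mulrDr.
have [||||_ _] := test_ge0 TW _ (g := fun x => x ^+ n) (C := 1).
- move=> A mA; apply/compared_indic => //; last exact: lawX.
  by move=> x x0; rewrite /W lerDl exprn_ge0.
- exact: exprn_measurable.
- by move=> x x0; exact: exprn_ge0.
- by move=> x x0; rewrite mul1r /W lerDr.
rewrite Rintegral_pdf_moment => <-; apply: eq_Rintegral => w _.
by rewrite mul1r.
Qed.

End ExponentialLaw.

(** * Mixture over the Bernoulli variable and the two implications *)

Section Characterization.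
Context d (T : measurableType d) (R : realType) (P : probability T R).
Variables (X Y eps : {RV P >-> R}) (p : R).
Hypothesis indepXY : indep_rv P X Y.
Hypothesis identXY : ident_distr X Y.
Hypothesis X_gt0 : {ae P, forall w, 0 < X w}.
Hypothesis Y_gt0 : {ae P, forall w, 0 < Y w}.
Hypothesis momX : forall n : nat, P.-integrable [set: T] (fun w => (X w ^+ n)%:E).
Hypothesis momY : forall n : nat, P.-integrable [set: T] (fun w => (Y w ^+ n)%:E).
Hypotheses (p_gt0 : 0 < p) (p_lt1 : p < 1).
Hypothesis eps1 : P [set w | eps w = 1] = p%:E.
Hypothesis eps0 : P [set w | eps w = 0] = (1 - p)%:E.
Hypothesis indep_eps : indep_rv P eps (fun w => (X w, Y w)).

Let q := 1 - p.
Let m n := \int[P]_w (X w ^+ n).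
Let U w := p * X w + (1 - eps w) * Y w.
Let V w := (1 - p) * X w + eps w * Y w.

Let mX : measurable_fun [set: T] X. Proof. exact: measurable_funP. Qed.
Let mY : measurable_fun [set: T] Y. Proof. exact: measurable_funP. Qed.
Let meps : measurable_fun [set: T] eps. Proof. exact: measurable_funP. Qed.

Let mpow k : measurable_fun [set: R] (fun x : R => x ^+ k).
Proof. exact: exprn_measurable. Qed.

Lemma moment_Y n : \int[P]_w (Y w ^+ n) = m n.
Proof.
rewrite /m /Rintegral; congr fine.
have mn : measurable_fun [set: R] (fun x : R => (x ^+ n)%:E).
  exact/measurable_EFinP.
have iX := integral_distribution (X := X) mn (momX n).
have iY := integral_distribution (X := Y) mn (momY n).
transitivity (\int[distribution P Y]_y (y ^+ n)%:E)%E; first exact/esym/iY.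
rewrite -[RHS]iX; apply: eq_measure_integral => A mA _; exact/esym/identXY.
Qed.

Lemma integrable_XY a b :
  P.-integrable [set: T] (EFin \o (fun w => X w ^+ a * Y w ^+ b)).
Proof.
exact: (indep_integrableM (A := X) (B := Y) indepXY
  (mpow a) (mpow b) (momX a) (momY b)).
Qed.

Lemma moment_XY a b : \int[P]_w (X w ^+ a * Y w ^+ b) = m a * m b.
Proof.
rewrite -(moment_Y b).
exact: (indep_RintegralM (A := X) (B := Y) indepXY
  (mpow a) (mpow b) (momX a) (momY b)).
Qed.

Let expand a n : (fun w => X w ^+ a * (q * X w + Y w) ^+ n) =
  fun w => \sum_(i < n.+1) (q ^+ (n - i) *+ 'C(n, i)) *
    (X w ^+ (n - i + a) * Y w ^+ i).
Proof.
apply/funext => w; rewrite exprDn mulr_sumr; apply: eq_bigr => i _.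
by rewrite exprMn exprD mulrnAr mulrnAl; congr (_ *+ _); ring.
Qed.

Lemma integrable_mixed a n : P.-integrable [set: T]
  (EFin \o (fun w => X w ^+ a * (q * X w + Y w) ^+ n)).
Proof.
rewrite expand; apply: integrable_sum_EFin => i.
by apply: integrableZ_EFin; exact: integrable_XY.
Qed.

Lemma moment_mixed a n :
  \int[P]_w (X w ^+ a * (q * X w + Y w) ^+ n) = mixed_moment q m a n.
Proof.
rewrite expand Rintegral_sum; last first.
  by move=> i; apply: integrableZ_EFin; exact: integrable_XY.
apply: eq_bigr => i _; rewrite RintegralZl//; last exact: integrable_XY.
by rewrite moment_XY.
Qed.

Let meps_eq e : measurable [set w | eps w = e].
Proof. by have := meps measurableT (measurable_set1 e); rewrite setTI. Qed.

(** The two prescribed probabilities add up to 1. *)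
Lemma eps_01 : {ae P, forall w, eps w = 1 \/ eps w = 0}.
Proof.
pose E := [set w | eps w = 1] `|` [set w | eps w = 0].
have mE : measurable E by apply: measurableU; exact: meps_eq.
have PE : P E = (P [set w | eps w = 1%R] + P [set w | eps w = 0%R])%E.
  apply: measureU; [exact: meps_eq..|].
  by apply/seteqP; split => w //= [-> /eqP]; rewrite oner_eq0.
exists (~` E); split; first exact: measurableC.
  rewrite probability_setC//.
  by rewrite PE eps1 eps0 -EFinD subrKC -[LHS]/((1 - 1)%:E) subrr.
by move=> w /=.
Qed.

Let XY : {mfun T >-> (R * R)%type} :=
  HB.pack (fun w => (X w, Y w))
    (isMeasurableFun.Build _ _ _ _ _ (measurable_fun_pair mX mY)).

Section Selection.
Variable (G : R * R -> R).
Hypothesis mG : measurable_fun [set: (R * R)%type] G.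
Hypothesis iG : P.-integrable [set: T] (EFin \o (fun w => G (X w, Y w))).

Let integrable_select_indic e :
  P.-integrable [set: T] (EFin \o (fun w => \1_[set e] (eps w))).
Proof.
exact: (integrable_indic P (meps_eq e)).
Qed.

Lemma integrable_select e :
  P.-integrable [set: T] (EFin \o (fun w => \1_[set e] (eps w) * G (X w, Y w))).
Proof.
apply: (indep_integrableM (A := eps) (B := XY) indep_eps) => //.
Qed.

Lemma Rintegral_select e :
  \int[P]_w (\1_[set e] (eps w) * G (X w, Y w)) =
  fine (P [set w | eps w = e]) * \int[P]_w G (X w, Y w).
Proof.
rewrite (indep_RintegralM (A := eps) (B := XY) indep_eps)//.
congr (_ * _); rewrite /Rintegral; congr fine.
by rewrite -(setIT [set w | eps w = e]) -integral_indic.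
Qed.

End Selection.

(** Almost surely [F] is the sum of [G1] and [G0] multiplied by the indicators of the two values of
    [eps], which are independent of [(X, Y)]. *)
Lemma Rintegral_mixture (G1 G0 : R * R -> R) (F : T -> R) :
  measurable_fun [set: (R * R)%type] G1 -> measurable_fun [set: (R * R)%type] G0 ->
  measurable_fun [set: T] F ->
  P.-integrable [set: T] (EFin \o (fun w => G1 (X w, Y w))) ->
  P.-integrable [set: T] (EFin \o (fun w => G0 (X w, Y w))) ->
  (forall w, eps w = 1 -> F w = G1 (X w, Y w)) ->
  (forall w, eps w = 0 -> F w = G0 (X w, Y w)) ->
  P.-integrable [set: T] (EFin \o F) /\
  \int[P]_w F w = p * \int[P]_w G1 (X w, Y w) + q * \int[P]_w G0 (X w, Y w).
Proof.
move=> mG1 mG0 mF iG1 iG0 F1 F0.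
pose H w := \1_[set 1] (eps w) * G1 (X w, Y w) + \1_[set 0] (eps w) * G0 (X w, Y w).
have iH : P.-integrable [set: T] (EFin \o H).
  by apply: integrableD_EFin; exact: integrable_select.
have FH : {ae P, forall w, F w = H w}.
  have := eps_01; apply: filterS => w; rewrite /H !indicE.
  move=> [ew|ew]; rewrite ew !in_set1 ?eqxx.
    by rewrite oner_eq0 mul1r mul0r addr0 F1.
  by rewrite eq_sym oner_eq0 mul1r mul0r add0r F0.
split; first exact: ae_eq_integrable iH.
rewrite (ae_eq_Rintegral mF _ FH); last exact/measurable_EFinP/measurable_int/iH.
rewrite RintegralD//; [|exact: integrable_select..].
by rewrite !Rintegral_select// eps1 eps0.
Qed.

Let measurable_U : measurable_fun [set: T] U.
Proof.
apply: measurable_funD; apply: measurable_funM => //; exact: measurable_funB.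
Qed.

Let measurable_V : measurable_fun [set: T] V.
Proof. by apply: measurable_funD; apply: measurable_funM. Qed.

Let mqxy n : measurable_fun [set: (R * R)%type] (fun z : R * R => (q * z.1 + z.2) ^+ n).
Proof.
by apply: measurable_funX; apply: measurable_funD => //; apply: measurable_funM.
Qed.

Let mqx n : measurable_fun [set: (R * R)%type] (fun z : R * R => (q * z.1) ^+ n).
Proof. by apply: measurable_funX; apply: measurable_funM. Qed.

Lemma moment_UV n : P.-integrable [set: T] (EFin \o (fun w => U w * V w ^+ n)) /\
  \int[P]_w (U w * V w ^+ n) = UV_moment p q m n.
Proof.
have E1 : (fun w => p * X w * (q * X w + Y w) ^+ n) =
    fun w => p * (X w ^+ 1 * (q * X w + Y w) ^+ n).
  by apply/funext => w; rewrite mulrA.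
have E0 : (fun w => (p * X w + Y w) * (q * X w) ^+ n) =
    fun w => (p * q ^+ n) * (X w ^+ n.+1) + q ^+ n * (X w ^+ n * Y w ^+ 1).
  by apply/funext => w; rewrite exprMn exprS expr1; ring.
have [||||||| iF ->] := @Rintegral_mixture
  (fun z => p * z.1 * (q * z.1 + z.2) ^+ n)
  (fun z => (p * z.1 + z.2) * (q * z.1) ^+ n) (fun w => U w * V w ^+ n).
- by apply: measurable_funM => //; apply: measurable_funM.
- by apply: measurable_funM => //; apply: measurable_funD => //; apply: measurable_funM.
- by apply: measurable_funM => //; exact: measurable_funX.
- by rewrite /= E1; apply: integrableZ_EFin; exact: integrable_mixed.
- rewrite /= E0; apply: integrableD_EFin; apply: integrableZ_EFin.
    exact: momX.
  exact: integrable_XY.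
- by move=> w; rewrite /U /V => ->; rewrite subrr mul0r addr0 mul1r.
- by move=> w; rewrite /U /V => ->; rewrite subr0 mul0r addr0 mul1r.
split=> //=; rewrite E1 E0 RintegralZl//; last exact: integrable_mixed.
rewrite moment_mixed RintegralD//; last 2 first.
  by apply: integrableZ_EFin; exact: momX.
  by apply: integrableZ_EFin; exact: integrable_XY.
rewrite !RintegralZl//; [|exact: integrable_XY|exact: momX].
by rewrite moment_XY /UV_moment -/(m n.+1) -[in LHS](mulrA p (q ^+ n)).
Qed.

Lemma moment_V n : P.-integrable [set: T] (EFin \o (fun w => V w ^+ n)) /\
  \int[P]_w (V w ^+ n) = V_moment p q m n.
Proof.
have E1 : (fun w => (q * X w + Y w) ^+ n) =
    fun w => X w ^+ 0 * (q * X w + Y w) ^+ n.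
  by apply/funext => w; rewrite mul1r.
have E0 : (fun w => (q * X w) ^+ n) = fun w => q ^+ n * X w ^+ n.
  by apply/funext => w; rewrite exprMn.
have [||||||| iF ->] := @Rintegral_mixture
  (fun z => (q * z.1 + z.2) ^+ n) (fun z => (q * z.1) ^+ n) (fun w => V w ^+ n).
- exact: mqxy.
- exact: mqx.
- exact: measurable_funX.
- by rewrite /= E1; exact: integrable_mixed.
- by rewrite /= E0; apply: integrableZ_EFin; exact: momX.
- by move=> w; rewrite /V => ->; rewrite mul1r.
- by move=> w; rewrite /V => ->; rewrite mul0r addr0.
split=> //=; rewrite E1 moment_mixed E0 RintegralZl//; last exact: momX.
Qed.

Let q_gt0 : 0 < q. Proof. by rewrite subr_gt0. Qed.
Let pq1 : p + q = 1. Proof. by rewrite /q addrC subrK. Qed.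

(** Nonnegativity of [V] places it where test functions are controlled; the bounds by [X + Y] carry
    exponential integrability over to [U] and [V]. *)
Let UV_bounds : {ae P, forall w, [/\ 0 <= V w, V w <= X w + Y w & `|U w| <= X w + Y w]}.
Proof.
move: X_gt0 Y_gt0 eps_01; apply: filterS3 => w /ltW X0 /ltW Y0.
have pX : p * X w <= X w by rewrite ler_piMl// ltW.
have qX : q * X w <= X w by rewrite ler_piMl// /q gerBl ltW.
have pX0 : 0 <= p * X w by rewrite mulr_ge0// ltW.
have qX0 : 0 <= q * X w by rewrite mulr_ge0// ltW.
rewrite /U /V -/q => -[->|->].
  by rewrite subrr mul0r mul1r addr0 ger0_norm//; split; lra.
by rewrite subr0 mul1r mul0r addr0 ger0_norm; [split; lra|lra].
Qed.

Let V_ge0 : {ae P, forall w, 0 <= V w}.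
Proof. by move: UV_bounds; apply: filterS => w []. Qed.

Let m0 : m 0%N = 1.
Proof.
rewrite /m (_ : (fun _ => _) = cst 1)// Rintegral_cst// mul1r.
by rewrite -[RHS]/(fine 1%E); congr fine; exact: probability_setT.
Qed.

(** Supplies a positive scale parameter. A zero mean would make the nonnegative [X] vanish almost
    surely. *)
Lemma moment1_gt0 : 0 < \int[P]_w (X w ^+ 1).
Proof.
rewrite -/(m 1%N); have m1_ge0 : 0 <= m 1%N.
  rewrite /m (@ae_eq_Rintegral _ _ _ _ _ (fun w => `|X w|)).
  - exact: Rintegral_ge0.
  - exact: measurable_funX.
  - exact: measurableT_comp.
  - by move: X_gt0; apply: filterS => w w0; rewrite gtr0_norm.
rewrite lt_neqAle m1_ge0 andbT; apply/negP => /eqP m1E.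
have iX : P.-integrable [set: T] (EFin \o X) by exact: (momX 1).
have X0 : ae_eq P [set: T] (EFin \o X) (cst 0%E).
  apply/ae_eq_integral_abs => //; first exact/measurable_EFinP.
  rewrite (@ae_eq_integral _ _ _ P [set: T] (EFin \o X))//.
  - by rewrite -(fineK (integrable_fin_num measurableT iX)) -[fine _]/(m 1%N) -m1E.
  - exact/measurableT_comp/measurable_EFinP.
  - exact/measurable_EFinP.
  - by move: X_gt0; apply: filterS => w w0 _; rewrite /= gtr0_norm.
(* An almost sure contradiction makes the null set [N] the whole space, which has probability 1. *)
have [N [mN PN0 subN]] : {ae P, forall w, False}.
  move: X_gt0 X0; apply: filterS2 => w w0 /(_ I) [] w1.
  by rewrite w1 ltxx in w0.
have NT : N = setT by apply/seteqP; split => // w _; apply: subN => /=.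
by move: PN0; rewrite NT probability_setT => /eqP; rewrite onee_eq0.
Qed.

(** A constant version gives [E(U; V in A) = c P(V in A)] for Borel [A]; [test_ge0] turns this into
    the moment identities, to which [exp_moment_unique] applies. *)
Lemma moments_of_constant : cond_exp_ae_constant P U V ->
  forall n, m n = exp_moment (m 1%N) n.
Proof.
move=> [Z [_ iZ ZU] [c Zc]].
have mZ : measurable_fun [set: T] Z by apply/measurable_EFinP/measurable_int/iZ.
have ind A : measurable A ->
    \int[P]_w (U w * \1_A (V w)) = \int[P]_w (cst c w * \1_A (V w)).
  move=> mA.
  have mVA : measurable (V @^-1` A) by rewrite -[X in measurable X]setTI; exact: measurable_V.
  transitivity (\int[P]_(w in V @^-1` A) Z w).
    by rewrite integral_indic_comp; congr fine; rewrite ZU//; exists A; rewrite ?setTI.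
  rewrite -integral_indic_comp.
  apply: ae_eq_Rintegral.
  - by apply: measurable_funM => //; apply: measurableT_comp => //; exact: measurable_indic.
  - by apply: measurable_funM => //; apply: measurableT_comp => //; exact: measurable_indic.
  - by move: Zc; apply: filterS => w ->.
have cE n : UV_moment p q m n = c * V_moment p q m n.
  (* No exponential moment is known yet; this weight only calls for the moments of orders 0 and
     [n]. *)
  pose W (x : R) := 1 + x ^+ n.
  have [iU eU] := moment_UV n; have [iV eV] := moment_V n.
  have TW : test_class W (same_integrals P P W U V (cst c) V).
    apply: same_integrals_test => //.
    - rewrite (_ : (fun _ => _) = fun w => U w * V w ^+ 0 + U w * V w ^+ n).
        by apply: integrableD_EFin => //; exact: (moment_UV 0).1.
      by apply/funext => w; rewrite /W mulrDr.
    - apply: integrableZ_EFin.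
      by apply: (@integrableD_EFin _ _ _ _ (fun w => V w ^+ 0)) => //; exact: (moment_V 0).1.
  have [||||_ _] := test_ge0 TW _ (g := fun x => x ^+ n) (C := 1).
  - move=> A mA; split; [exact: measurable_indic| |exact: ind].
    exists 1 => x x0; rewrite mul1r /W (@le_trans _ _ 1)//.
      by rewrite indicE; case: (_ \in _); rewrite ?normr1 ?normr0.
    by rewrite lerDl exprn_ge0.
  - exact: exprn_measurable.
  - by move=> x x0; exact: exprn_ge0.
  - by move=> x x0; rewrite mul1r /W lerDr.
  by rewrite eU RintegralZl// eV.
apply: (exp_moment_unique p_gt0 q_gt0 pq1 m0) => n.
(* The identity of order 0 reads [E U = c], and [E U] is the mean of [X]. *)
suff -> : m 1%N = c by exact: cE.
by have := cE 0%N; rewrite UV_moment0// V_moment0// mulr1.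
Qed.

Lemma constant_of_moments lam : 0 < lam ->
  (forall n, m n = exp_moment lam n) -> cond_exp_ae_constant P U V.
Proof.
move=> lam0 mE.
(* [X] and [Y] have exponential moments at rate [(2 * lam)^-1 = 6 * h]. With [s = X + Y], the norm
   of [U] costs [expR (h * s)] and [W (V w)] costs [expR (2 * h * s)]; separating [X] from [Y] in
   [expR (3 * h * s)] doubles the rate. *)
pose h := (12 * lam)^-1.
have h0 : 0 < h by rewrite invr_gt0 mulr_gt0.
have h6 : (2 * lam)^-1 = 6 * h by rewrite /h; field; rewrite gt_eqF.
pose W x := expR (2 * h * x).
have mYE n : \int[P]_w (Y w ^+ n) = exp_moment lam n.
  by rewrite -mE; exact: moment_Y.
have iX := integrable_expR_RV X_gt0 momX lam0 mE.
have iY := integrable_expR_RV Y_gt0 momY lam0 mYE.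
rewrite h6 in iX iY.
have iXY K : P.-integrable [set: T]
    (EFin \o (fun w => K * (expR (6 * h * X w) + expR (6 * h * Y w)))).
  by apply: integrableZ_EFin; exact: integrableD_EFin.
(* This is [a * b <= a * a + b * b] for nonnegative [a] and [b]. *)
have expXY (x y : R) : expR (3 * h * (x + y)) <= expR (6 * h * x) + expR (6 * h * y).
  have -> : 3 * h * (x + y) = 3 * h * x + 3 * h * y by ring.
  have -> : 6 * h * x = 3 * h * x + 3 * h * x by ring.
  have -> : 6 * h * y = 3 * h * y + 3 * h * y by ring.
  rewrite !expRD; set a := expR _; set b := expR _.
  have a0 : 0 <= a by exact: expR_ge0.
  have b0 : 0 <= b by exact: expR_ge0.
  nra.
have mW : measurable_fun [set: T] (fun w => W (V w)).
  apply: measurableT_comp; last exact: measurable_V.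
  by apply: measurableT_comp => //; exact: measurable_funM.
have iU : P.-integrable [set: T] (EFin \o (fun w => U w * W (V w))).
  apply: ae_le_integrable (iXY h^-1); first exact: measurable_funM.
  move: UV_bounds; apply: filterS => w [V0 Vle Ule].
  have XY0 : 0 <= X w + Y w by rewrite (le_trans (normr_ge0 _) Ule).
  rewrite normrM (ger0_norm (expR_ge0 _)).
  apply: (@le_trans _ _ (h^-1 * expR (h * (X w + Y w)) * expR (2 * h * (X w + Y w)))).
    apply: ler_pM => //.
      apply: (le_trans Ule); have := exprn_le_expRM 1 h0 XY0.
      by rewrite expr1 ger0_norm// mul1r.
    by rewrite ler_expR ler_wpM2l// mulr_ge0// ltW.
  have hV0 : 0 <= h^-1 by rewrite invr_ge0 ltW.
  rewrite -mulrA -expRD ler_wpM2l//.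
  apply: le_trans (expXY _ _); rewrite ler_expR; nra.
have iC : P.-integrable [set: T] (EFin \o (fun w => cst lam w * W (V w))).
  apply: ae_le_integrable (iXY lam).
    exact: (measurable_funM (measurable_cst lam) mW).
  move: UV_bounds; apply: filterS => w [V0 Vle _].
  have XY0 : 0 <= X w + Y w by lra.
  rewrite normrM (ger0_norm (expR_ge0 _)) gtr0_norm// ler_wpM2l//; first exact: ltW.
  apply: le_trans (expXY _ _); rewrite ler_expR; nra.
have ind A : measurable A ->
    \int[P]_w (U w * \1_A (V w)) = \int[P]_w (cst lam w * \1_A (V w)).
  move=> mA.
  have [] // := @test_indic _ h (same_integrals P P W U V (cst lam) V) h0 _ _ A mA.
  - exact: same_integrals_test.
  - move=> k; split => //.
    + by exists (k`!%:R / (2 * h) ^+ k) => x x0; apply: exprn_le_expRM => //; rewrite mulr_gt0.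
    + have [_ ->] := moment_UV k; have [iVk eV] := moment_V k.
      rewrite RintegralZl// eV (_ : m = exp_moment lam); last exact/funext.
      exact: UV_moment_exp.
exists (cst lam); last by exists lam; apply: aeW.
have iU1 : P.-integrable [set: T] (EFin \o U).
  have [iU0 _] := moment_UV 0; apply: eq_integrable iU0 => // w _ /=.
  by rewrite expr0 mulr1.
split => //; first exact: finite_measure_integrable_cst.
(* Events generated by [V] are preimages of Borel sets, so [ind] applies; finiteness of both
   integrals lifts its real equality to the extended reals. *)
move=> A [B mB]; rewrite setTI => <-.
have mVB : measurable (V @^-1` B) by rewrite -[X in measurable X]setTI; exact: measurable_V.
have := ind _ mB; rewrite !integral_indic_comp /Rintegral => eB.
have fU : (\int[P]_(w in V @^-1` B) (U w)%:E \is a fin_num)%E.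
  by apply: integrable_fin_num => //; apply: integrableS iU1.
have fl : (\int[P]_(w in V @^-1` B) (cst lam w)%:E \is a fin_num)%E.
  by apply: integrable_fin_num => //; exact: finite_measure_integrable_cst.
by rewrite -(fineK fl) -(fineK fU) eB.
Qed.

End Characterization.

Theorem theorem2p6 (d : measure_display) (T : measurableType d) (R : realType)
    (P : probability T R) (X Y eps : {RV P >-> R}) (p : R)
    (indepXY : indep_rv P X Y)
    (identXY : ident_distr X Y)
    (X_gt0 : {ae P, forall w, 0 < X w})
    (Y_gt0 : {ae P, forall w, 0 < Y w})
    (momX : forall n : nat, P.-integrable [set: T] (fun w => (X w ^+ n)%:E))
    (momY : forall n : nat, P.-integrable [set: T] (fun w => (Y w ^+ n)%:E))
    (p_gt0 : 0 < p) (p_lt1 : p < 1)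
    (eps1 : P [set w | eps w = 1] = p%:E)
    (eps0 : P [set w | eps w = 0] = (1 - p)%:E)
    (indep_eps : indep_rv P eps (fun w => (X w, Y w))) :
  cond_exp_ae_constant P
    (fun w => p * X w + (1 - eps w) * Y w)
    (fun w => (1 - p) * X w + eps w * Y w)
  <-> exponentially_distributed X.
Proof.
split=> [cst_UV|[lam lam_gt0 lawX]].
  (* The scale parameter is the mean of [X]. *)
  apply: (exponential_of_moments X_gt0 momX (moment1_gt0 X_gt0 momX)).
  exact: (moments_of_constant indepXY identXY X_gt0 Y_gt0 momX momY
    p_gt0 p_lt1 eps1 eps0 indep_eps cst_UV).
apply: (constant_of_moments indepXY identXY X_gt0 Y_gt0 momX momY
  p_gt0 p_lt1 eps1 eps0 indep_eps lam_gt0).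
exact: moments_of_exponential.
Qed.
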